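(* Let $n, k, \ell$ denote integers with $n > k > \ell \ge 0$. (i) For every $\ell \ge 0$, if $k = \ell+1$, then for every $n > k$ there exists an $n$-vertex tight $(k,\ell)$-stable graph. (ii) For every $\ell \ge 0$, if $k = \ell+2$, then for every $n > k$ there exists an $n$-vertex tight $(k,\ell)$-stable graph.
   Context: All graphs are finite, undirected, and simple. $\alpha(G)$ denotes the independence number of $G$. For vertices $v_1,\ldots,v_k$ of $G$, $G \setminus \{v_1,\ldots,v_k\}$ denotes the induced subgraph of $G$ on $V(G)\setminus\{v_1,\ldots,v_k\}$. For integers $k > \ell \ge 0$, a graph $G$ is called $(k,\ell)$-stable if for every $k$ vertices $v_1,\ldots,v_k$ of $G$, $\alpha(G\setminus\{v_1,\ldots,v_k\}) \ge \alpha(G) - \ell$. An $n$-vertex graph $G$ is called tight $(k,\ell)$-stable if it is $(k,\ell)$-stable and $\alpha(G) = \left\lfloor \frac{n-k+1}{2} \right\rfloor + \ell$. *)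

(* Defs.v *)
From mathcomp Require Import all_boot.

Set Implicit Arguments.
Unset Strict Implicit.
Unset Printing Implicit Defensive.

Record sgraph := SGraph {
  vertex :> finType;
  adj : rel vertex;
  adj_sym : symmetric adj;
  adj_irr : irreflexive adj
}.

Definition independent (G : sgraph) (A : {set G}) : bool :=
  [forall x in A, forall y in A, ~~ adj x y].

Definition alpha (G : sgraph) : nat :=
  \max_(A : {set G} | independent A) #|A|.

Section Delete.
Variables (G : sgraph) (S : {set G}).

Definition del_adj : rel {x : G | x \notin S} :=
  fun x y => adj (val x) (val y).

Lemma del_adj_sym : symmetric del_adj.
Proof. by move=> x y; rewrite /del_adj adj_sym. Qed.

Lemma del_adj_irr : irreflexive del_adj.
Proof. by move=> x; rewrite /del_adj adj_irr. Qed.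

(* G \ S, the subgraph of G induced on the vertices outside S. *)
Definition delete : sgraph := SGraph del_adj_sym del_adj_irr.
End Delete.

(* "Every k vertices" means every set of k distinct vertices. The inequality
   alpha(G \ S) >= alpha(G) - l is stated without subtraction. *)
Definition stable (k l : nat) (G : sgraph) : Prop :=
  forall S : {set G}, #|S| = k -> alpha G <= alpha (delete S) + l.

(* The subtraction is truncated, hence meaningful only for k <= #|G| + 1;
   tightness is only considered for k < #|G|. *)
Definition tight_stable (k l : nat) (G : sgraph) : Prop :=
  stable k l G /\ alpha G = (#|G| + 1 - k)./2 + l.

(* Main.v *)
(* Take l isolated vertices together with a graph H on m vertices 0, ..., m - 1,
   where distinct x and y are adjacent iff |x - y| = 1 or |x - y| >= 2q. For
   m = 2q, 2q + 1, 2q + 2, this H is a path, an odd cycle, and an odd cycle with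
   one vertex duplicated by an adjacent twin. An independent set of H lies in a
   window of 2q consecutive integers and has no two consecutive elements, so it
   has at most q elements.
   Conversely, starting at any c and going around the cycle, every other vertex
   gives an independent q-set missing c; choosing c by parity, it can be made to
   miss any two given vertices. Among l + j deleted vertices at least j
   lie in H, and some independent set of size q + l misses j of these, hence
   loses at most l elements. *)
Require Import Defs.
From mathcomp Require Import all_boot zify.

Lemma independentP (G : sgraph) (A : {set G}) :
  reflect {in A &, forall x y, ~~ adj x y} (independent A).
Proof.
apply: (iffP forall_inP) => [iA x y xA yA | iA x xA].
  by have /forall_inP := iA x xA; apply.
by apply/forall_inP => y yA; apply: iA.
Qed.

Lemma alpha_delete_ge (G : sgraph) (S B : {set G}) :
  independent B -> #|B :\: S| <= alpha (delete S).
Proof.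
move=> /independentP iB.
set B' : {set delete S} := [set x | val x \in B].
have iB' : independent B'.
  by apply/independentP => x y; rewrite !inE; apply: iB.
apply: leq_trans (leq_bigmax_cond _ iB').
rewrite -(card_imset _ val_inj); apply/subset_leq_card/subsetP => x.
rewrite inE => /andP[xS xB]; apply/imsetP.
by exists (exist _ x xS); rewrite ?inE.
Qed.

Section WindowGraph.
Variables q m l : nat.

Definition window_adj (x y : 'I_(m + l)) : bool :=
  [&& x < m, y < m, x != y &
      [|| x.+1 == y, y.+1 == x, q.*2 + x <= y | q.*2 + y <= x]].

Lemma window_adj_sym : symmetric window_adj.
Proof. by move=> x y; rewrite /window_adj -!val_eqE /=; apply/idP/idP; lia. Qed.

Lemma window_adj_irr : irreflexive window_adj.
Proof. by move=> x; rewrite /window_adj eqxx !andbF. Qed.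

Definition window_graph : sgraph := SGraph window_adj_sym window_adj_irr.

Lemma window_independent_le (A : {set window_graph}) :
  0 < q -> m <= q.*2.+2 -> independent A -> #|A| <= q + l.
Proof.
move=> q_gt0 m_le /independentP iA.
have [a aA] : exists a, forall x : 'I_(m + l), x \in A -> x < m ->
    (a <= x) && (x < a + q.*2).
  have [/existsP[x0 x0P] | no_x] := boolP [exists x : 'I_(m + l), (x \in A) && (x < m)].
    pose P (x : 'I_(m + l)) := (x \in A) && (x < m).
    have [a /andP[aA am] amin] := @arg_minnP _ x0 P (@nat_of_ord _) x0P.
    exists a => x xA xm.
    have ax : a <= x by apply: amin; rewrite /P xA.
    by have := iA a x aA xA; rewrite /= /window_adj -val_eqE /=; lia.
  exists 0 => x xA xm; case/negP: no_x.
  by apply/existsP; exists x; rewrite xA.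
(* The window splits into [q] pairs of consecutive, hence adjacent, vertices, each with at most one
   element of [A]. Values from [q] on encode the isolated vertices. *)
pose f (x : nat) := if x < m then (x - a)./2 else q + (x - m).
have f_lt (x : 'I_(m + l)) : x \in A -> f x < q + l.
  by move=> xA; have := aA x xA; have := ltn_ord x; rewrite /f; case: ifP; lia.
have ql_gt0 : 0 < q + l by lia.
pose F (x : 'I_(m + l)) : 'I_(q + l) := insubd (Ordinal ql_gt0) (f x).
have F_inj : {in A &, injective F}.
  move=> x y xA yA /(congr1 val).
  rewrite !val_insubd !f_lt // => fxy; apply/val_inj => /=; move: fxy.
  have := iA x y xA yA; rewrite /= /window_adj -val_eqE /=.
  have := aA x xA; have := aA y yA; have := ltn_ord x; have := ltn_ord y.
  by rewrite /f; do 2 case: ifP; lia.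
by have := max_card (F @: A); rewrite card_in_imset // card_ord.
Qed.

(* Every other vertex of the odd cycle 0, ..., 2q starting at c + 1, together
   with all isolated vertices. *)
Definition alternating (c : nat) : {set window_graph} :=
  [set x : 'I_(m + l) | (m <= x) || (x <= q.*2) && (odd (x + c) == (c <= x))].

(** Among elements below [m], two on the same side of [c] differ by an even number below 2q; two on
    opposite sides differ by an odd number, at least 3 and below 2q. *)
Lemma alternating_independent c : c <= q.*2.+1 -> independent (alternating c).
Proof.
move=> c_le; apply/independentP => x y; rewrite !inE /= /window_adj -val_eqE /=.
by lia.
Qed.

(** For odd [c] below 2q the cycle part ends at 2q itself, which must then be less than [m]. *)
Lemma alternating_card c :
  c <= q.*2.+1 -> q.*2 + odd c <= m -> q + l <= #|alternating c|.
Proof.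
move=> c_le c_m.
pose h i := if i < q then
              if i.*2 + odd c < c then i.*2 + odd c else (i.*2 + odd c).+1
            else m + (i - q).
have h_lt (i : 'I_(q + l)) : h i < m + l.
  by have := ltn_ord i; rewrite /h; do 2?case: ifP; lia.
pose H i : 'I_(m + l) := Ordinal (h_lt i).
have H_inj : injective H.
  move=> i j /(congr1 val) /= hij; apply/val_inj => /=; move: hij.
  by have := ltn_ord i; have := ltn_ord j; rewrite /h; do 4?case: ifP; lia.
rewrite -[q + l]card_ord -(card_imset _ H_inj).
apply/subset_leq_card/subsetP => _ /imsetP[i _ ->].
by rewrite inE /= /h; have := ltn_ord i; do 2?case: ifP; lia.
Qed.

Lemma alpha_window_graph :
  0 < q -> q.*2 <= m <= q.*2.+2 -> alpha window_graph = q + l.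
Proof.
move=> q_gt0 /andP[m_ge m_le]; apply/eqP; rewrite eqn_leq; apply/andP; split.
  by apply/bigmax_leqP => A; apply: window_independent_le.
have i0 : independent (alternating 0) by apply: alternating_independent.
by apply: leq_trans (leq_bigmax_cond _ i0); apply: alternating_card; lia.
Qed.

(* For m = 2q the cycle vertex 2q is not a vertex of the path, so it must be one
   of the two vertices avoided: hence the hypothesis b = m. *)
Lemma alternating_avoid a b :
  a < b -> a < m -> b <= q.*2.+1 -> q.*2 <= m -> (q.*2 = m -> b = m) ->
  exists c, [/\ independent (alternating c), q + l <= #|alternating c| &
    forall x : 'I_(m + l), x < m -> x = a :> nat \/ x = b :> nat ->
      x \notin alternating c].
Proof.
(* Elements below [c] share its parity, those above have the opposite one. If m = 2q, then [b] is
   even, and so is the chosen [c]. *)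
move=> ab am bq m_ge bm; exists (if odd (a + b) then b else a).
split; [apply: alternating_independent | apply: alternating_card |];
  try by case: ifP; lia.
by move=> x xm xab; rewrite inE /=; case: ifP; lia.
Qed.

(** [B] meets [S] only outside [T], so it loses at most [l] elements. *)
Lemma window_delete_ge (S T B : {set window_graph}) :
  independent B -> q + l <= #|B| -> T \subset S -> [disjoint T & B] ->
  #|S| <= #|T| + l -> q <= alpha (delete S).
Proof.
move=> iB B_ge TS TB S_le; apply: leq_trans (alpha_delete_ge _ _ _ iB).
have sub : B :&: S \subset S :\: T.
  apply/subsetP => x; rewrite !inE => /andP[xB ->].
  by rewrite andbT (contraTN _ xB) // => /(disjointFr TB) ->.
have := subset_leq_card sub; rewrite cardsD (setIidPr TS).
by have := cardsID S B; lia.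
Qed.

Lemma card_deleted_core (S : {set window_graph}) :
  #|S| <= #|[set x : 'I_(m + l) in S | x < m]| + l.
Proof.
rewrite -(cardsID [set x : 'I_(m + l) | x < m] S).
rewrite (_ : S :&: _ = [set x : 'I_(m + l) in S | x < m]); last first.
  by apply/setP => x; rewrite !inE.
rewrite leq_add2l -[leqRHS]card_ord -(card_imset _ (@rshift_inj m l)).
apply/subset_leq_card/subsetP => x; rewrite !inE -leqNgt => /andP[xm _].
apply/imsetP; have x_lt : x - m < l by have := ltn_ord x; lia.
by exists (Ordinal x_lt) => //; apply/val_inj => /=; lia.
Qed.

End WindowGraph.

Lemma window_tight_stable1 (q m l : nat) :
  0 < q -> q.*2 <= m <= q.*2.+1 -> tight_stable (l + 1) l (window_graph q m l).
Proof.
move=> q_gt0 /andP[m_ge m_le]; rewrite /tight_stable /stable.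
rewrite alpha_window_graph; try by lia.
split; last by rewrite card_ord; lia.
move=> S cS; rewrite leq_add2r.
have S0_gt0 : 0 < #|[set x : 'I_(m + l) in S | x < m]|.
  by have := card_deleted_core q m l S; lia.
have [a] := card_gt0P S0_gt0; rewrite inE => /andP[aS am].
(* Only [a] has to be avoided; the dummy second value [m] also covers the path case. *)
have [//|c [ic cc avoid]] := alternating_avoid q m l a m am am m_le m_ge.
apply: (window_delete_ge q m l S [set a] _ ic cc); rewrite ?sub1set ?cards1 //.
  by rewrite disjoints1 avoid //; left.
by lia.
Qed.

Lemma window_tight_stable2 (q m l : nat) :
  0 < q -> q.*2 < m <= q.*2.+2 -> tight_stable (l + 2) l (window_graph q m l).
Proof.
move=> q_gt0 /andP[m_gt m_le]; rewrite /tight_stable /stable.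
rewrite alpha_window_graph; try by lia.
split; last by rewrite card_ord; lia.
move=> S cS; rewrite leq_add2r.
have S0_gt1 : 1 < #|[set x : 'I_(m + l) in S | x < m]|.
  by have := card_deleted_core q m l S; lia.
have [a [b [aS0 bS0 ab]]] := card_gt1P S0_gt1.
wlog lt_ab : a b aS0 bS0 ab / a < b => [hwlog|].
  have : (a : nat) != b by [].
  by rewrite neq_ltn => /orP[]; [|rewrite eq_sym in ab]; apply: hwlog.
move: aS0 bS0; rewrite !inE => /andP[aS am] /andP[bS bm].
have [|||c [ic cc avoid]] := alternating_avoid q m l a b lt_ab am; try by lia.
apply: (window_delete_ge q m l S [set a; b] _ ic cc).
- by rewrite subUset !sub1set aS.
- rewrite disjoint_subset; apply/subsetP => x.
  rewrite in_set2 => /orP[] /eqP ->; [have := avoid a am | have := avoid b bm];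
    by apply; [left + right].
- by rewrite cards2 ab; lia.
Qed.

Theorem theorem4 :
  (forall l k n : nat, l < k -> k < n -> k = l + 1 ->
     exists G : sgraph, #|G| = n /\ tight_stable k l G) /\
  (forall l k n : nat, l < k -> k < n -> k = l + 2 ->
     exists G : sgraph, #|G| = n /\ tight_stable k l G).
Proof.
split=> l k n _ + kE; rewrite {}kE => lt_n.
  exists (window_graph (n - l)./2 (n - l) l); split; first by rewrite card_ord; lia.
  by apply: window_tight_stable1; lia.
(* Rounding half of m - 1 down makes [m] equal to 2q + 1 or 2q + 2, which excludes the path. *)
exists (window_graph (n - l).-1./2 (n - l) l); split; first by rewrite card_ord; lia.
by apply: window_tight_stable2; lia.
Qed.
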